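(* Let $x$ be a homogeneously adequate state of a connected oriented link diagram $D\subset S^2$, and let $i_x,j_x$ be the integers defined in the context. Then each of $\mathcal{C}^{i_x,j_x+1}_{\mathbb{F}_2}(x)$ and $\mathcal{C}^{i_x,j_x-1}_{\mathbb{F}_2}(x)$ contains a representative of a nonzero Khovanov homology class, i.e. a chain $X$ with $dX=0$ which is not of the form $dY$ with $Y\in\mathcal{C}_{\mathbb{F}_2}(D)$. If in addition the graph $G_{x_A}$ is bipartite, then each of $\mathcal{C}^{i_x,j_x+1}_{\mathbb{Z}}(x)$ and $\mathcal{C}^{i_x,j_x-1}_{\mathbb{Z}}(x)$ also contains a representative of a nonzero homology class (of $\mathcal{C}_{\mathbb{Z}}(D)$).
   Context: States. Let $D\subset S^2$ be a connected link diagram with crossings $c^1,\dots,c^n$. A (Kauffman) state $x$ of $D$ is obtained by choosing at each crossing the $A$-smoothing or the $B$-smoothing (standard Kauffman convention); it consists of disjoint circles in $S^2$ (state circles) together with one crossing arc for each crossing, labeled $A$ or $B$ according to the smoothing, joining the two strands of the smoothed crossing. An enhancement $X$ of $x$ assigns a label $0$ or $1$ to each state circle. Chain complex. For a ring $R$ with $1$, $\mathcal{C}_R(x)$ is the free $R$-module on the enhancements of $x$, and $\mathcal{C}_R(D)=\bigoplus_x\mathcal{C}_R(x)$ over all states $x$ of $D$. For an enhancement $X$ of $x$ and a crossing $c$: if $x$ has the $B$-smoothing at $c$, then $d_cX=0$. If $x$ has the $A$-smoothing at $c$, $d_cX$ is supported on the state obtained by changing the smoothing at $c$ to $B$, with all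 labels on circles not incident to the arc at $c$ unchanged, and: if the arc at $c$ joins two distinct circles, these merge, with labels $(1,1)\mapsto 0$ (the zero chain), $(0,1),(1,0)\mapsto$ one circle labeled $1$, $(0,0)\mapsto$ one circle labeled $0$; if the arc at $c$ joins a circle to itself, that circle splits in two, with label $1\mapsto$ labels $(1,1)$, and label $0\mapsto$ the sum of the enhanced states with labels $(1,0)$ and $(0,1)$. Then $dX=\sum_t(-1)^{a_t(X)}d_{c^t}X$, where $a_t(X)$ is the number of $s<t$ such that $x$ has an $A$-smoothing at $c^s$; extend $R$-linearly. One has $d\circ d=0$; cycles are elements of $\ker d$, exact chains are elements of $\operatorname{im} d$, and Khovanov homology is $\ker d/\operatorname{im} d$. Gradings. Let $w_D$ be the writhe of $D$, $\sigma_x=\#(A\text{-smoothings of }x)-\#(B\text{-smoothings of }x)$, and $i_x=\frac12(w_D-\sigma_x)$. For an enhancement $X$ of $x$, let $\tau_X=\#(1\text{-labeled circles})-\#(0\text{-labeled circles})$ and $j_X=w_D+i_x-\tau_X$. $\mathcal{C}_R^{i,j}(x)$ is the submodule of $\mathcal{C}_R(x)$ generated by the enhancements $X$ of $x$ with $i_x=i$, $j_X=j$. Homogeneous adequacy. $G_x$ is the graph obtained from $x$ by collapsing each state circle to a vertex, with the crossing arcs as ($A$- or $B$-labeled) edges. Cut $G_x$ simultaneously along all its cut vertices (vertices whose deletion disconnects $G_x$); the subsets of $x$ corresponding to the resulting connected components are the blocks of $x$. The state $x$ is homogeneous if no block contains both $A$- and $B$-type crossing arcs, adequate if each crossing arc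 joins two distinct state circles, and homogeneously adequate if both. $x_A$ (resp. $x_B$) is the union of all $A$-type (resp. $B$-type) crossing arcs and the state circles incident to them; $G_{x_A}$ is the graph obtained from $x_A$ by collapsing each state circle to a vertex. For homogeneous $x$, the $A$-zones (resp. $B$-zones) of $x$ are the connected components of $x_A$ (resp. $x_B$). The integer $j_x$. With $|\bigcirc|_{x_A}$, $|\bigcirc|_{x_B}$ the numbers of state circles in $x_A$, $x_B$, $$j_x=w_D+i_x+|\bigcirc|_{x_B}-|\bigcirc|_{x_A}+\#(A\text{-zones of }x)-\#(B\text{-zones of }x).$$ *)

(* Defs.v *)
From HB Require Import structures.
From mathcomp Require Import all_boot all_order all_algebra.

Set Implicit Arguments.
Unset Strict Implicit.
Unset Printing Implicit Defensive.

Import GRing.Theory Num.Theory.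
Local Open Scope ring_scope.

(* Oriented link diagrams on the 2-sphere, up to isotopy, as combinatorial
   maps (planar-diagram codes): the crossing c has four half-edges ("darts")
   (c, 0), (c, 1), (c, 2), (c, 3), listed counterclockwise, where (c, 0) and
   (c, 2) lie on the under-strand and (c, 1) and (c, 3) on the over-strand.
   [glue] matches the two darts of each edge.  [out d] says that the
   orientation of the link points away from the crossing along d.
   [nloop] is the number of components without any crossing; it is needed for
   the crossingless diagram of the unknot. *)
Definition dart_rot (n : nat) (d : 'I_n * 'I_4) : 'I_n * 'I_4 := (d.1, ordS d.2).

Definition dart_adj (n : nat) (glue : 'I_n * 'I_4 -> 'I_n * 'I_4) :
  rel ('I_n * 'I_4) := fun d e => (d.1 == e.1) || (glue d == e).

(* [planar] is Euler's formula V - E + F = 2 * #components for the underlying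
   4-valent graph (V = ncross, E = 2 * ncross), whose faces are the orbits of
   [dart_rot \o glue]. *)
Record link_diagram := LinkDiagram {
  ncross : nat;
  nloop : nat;
  glue : 'I_ncross * 'I_4 -> 'I_ncross * 'I_4;
  out : 'I_ncross * 'I_4 -> bool;
  glueK : involutive glue;
  out_glue : forall d, out (glue d) = ~~ out d;
  out_opp : forall d, out (dart_rot (dart_rot d)) = ~~ out d;
  planar : fcard (@dart_rot ncross \o glue) predT
           = (ncross + 2 * n_comp (dart_adj glue) predT)%N
}.

Definition connected (D : link_diagram) : bool :=
  (n_comp (dart_adj (@glue D)) predT + nloop D == 1)%N.

Notation crossing D := 'I_(ncross D).

(* Each crossingless component contributes one point of its own. *)
Notation point D := ('I_(ncross D) * 'I_4 + 'I_(nloop D))%type.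

(* Under-strand d0 -> d2 and over-strand d3 -> d1 (or both reversed) form a
   positive crossing. *)
Definition crossing_sign (D : link_diagram) (c : crossing D) : int :=
  if out (c, 1) == out (c, 2) then 1 else -1.

Definition writhe (D : link_diagram) : int := \sum_(c < ncross D) crossing_sign c.

(* [x c] is false for the A-smoothing and true for the B-smoothing. *)
Definition state (D : link_diagram) := {ffun crossing D -> bool}.

(* The A-regions, swept by rotating the over-strand counterclockwise, are those
   between darts 1 and 2 and between darts 3 and 0.  The A-smoothing merges
   them, hence joins the darts 0-1 and 2-3; the B-smoothing joins 0-3 and 1-2. *)
Definition smooth_ord (b : bool) (i : 'I_4) : 'I_4 :=
  if odd i (+) b then ord_pred i else ordS i.

Section States.
Variable D : link_diagram.
Implicit Types (x : state D) (c : crossing D) (p q : point D).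

Definition circle_adj x : rel (point D) := fun p q =>
  match p, q with
  | inl d, inl e => (glue d == e) || ((d.1, smooth_ord (x d.1) d.2) == e)
  | _, _ => p == q
  end.

(* A state circle is recorded as the set of points lying on it. *)
Definition circle_set x p : {set point D} := [set q | connect (circle_adj x) p q].

Definition circles x : {set {set point D}} := [set circle_set x p | p in predT].

Definition circle x := {C : {set point D} | C \in circles x}.

Definition circle_of x p : circle x :=
  exist _ (circle_set x p) (imset_f (circle_set x) (isT : p \in predT)).

(* In both smoothings the darts 0 and 2 lie on the two different strands, so
   these are the two feet of the crossing arc at c. *)
Definition foot (c : crossing D) (b : bool) : point D :=
  inl (c, if b then 2 else 0).

Definition arc_end x c b : circle x := circle_of x (foot c b).

Definition adequate x : bool := [forall c, arc_end x c false != arc_end x c true].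

(* The graph G_x has vertex set [circle x] and edge set [crossing D], the edge
   c having the two ends [arc_end x c]. *)
Definition joins x c (C C' : circle x) : bool :=
  [exists b, (arc_end x c b == C) && (arc_end x c (~~ b) == C')].

Definition del_adj x (V : circle x) : rel (circle x) := fun C C' =>
  [&& C != V, C' != V & [exists c, joins c C C']].

Definition cut_vertex x (V : circle x) : bool :=
  [exists C, exists C', [&& C != V, C' != V & ~~ connect (del_adj V) C C']].

(* Cutting G_x along a cut vertex V replaces V by one copy for each component
   of G_x - V (a loop at V falls off as a piece of its own).  Hence two edges
   sharing an end V still share it after all the cuts unless V is a cut vertex
   and the edges lead to different components of G_x - V. *)
Definition cut_adj x : rel (crossing D) := fun c c' =>
  [exists b, exists b', let V := arc_end x c b in
    (arc_end x c' b' == V) &&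
    (cut_vertex V ==> [&& arc_end x c (~~ b) != V, arc_end x c' (~~ b') != V
                        & connect (del_adj V) (arc_end x c (~~ b))
                                              (arc_end x c' (~~ b'))])].

(* The blocks of x, each recorded as its set of crossing arcs. *)
Definition blocks x : {set {set crossing D}} :=
  [set [set c' | connect (cut_adj x) c c'] | c in predT].

Definition homogeneous x : bool :=
  [forall B in blocks x, ~~ ([exists c in B, ~~ x c] && [exists c in B, x c])].

Definition homogeneously_adequate x : bool := homogeneous x && adequate x.

(* Below, [t] is false for x_A and true for x_B. *)
Definition part_circles x (t : bool) : {set circle x} :=
  [set C | [exists c, exists b, (x c == t) && (arc_end x c b == C)]].

Definition part_adj x (t : bool) : rel (circle x) := fun C C' =>
  [exists c, (x c == t) && joins c C C'].

Definition nzones x (t : bool) : nat := n_comp (part_adj t) (part_circles x t).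

(* Bipartiteness of G_{x_A} (t = false) or G_{x_B} (t = true): the colours of
   circles outside the subgraph are unconstrained. *)
Definition part_bipartite x (t : bool) : Prop :=
  exists col : circle x -> bool,
    forall c, x c = t -> col (arc_end x c false) != col (arc_end x c true).

Definition sigma x : int := #|[set c | ~~ x c]|%:Z - #|[set c | x c]|%:Z.

(* The division is exact, see [i_degE]. *)
Definition i_deg x : int := ((writhe D - sigma x) %/ 2)%Z.

Definition j_state x : int :=
  writhe D + i_deg x + #|part_circles x true|%:Z - #|part_circles x false|%:Z
  + (nzones x false)%:Z - (nzones x true)%:Z.

Lemma i_degE x : i_deg x * 2 = writhe D - sigma x.
Proof.
have sigmaE : sigma x = \sum_(c < ncross D) (if x c then -1 else 1).
  rewrite (bigID (fun c => x c)) /= (eq_bigr (fun=> -1)); last by move=> c ->.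
  rewrite [X in _ + X](eq_bigr (fun=> 1)); last by move=> c /negPf ->.
  by rewrite !sumr_const /sigma !cardsE addrC mulNrn !natz.
rewrite /i_deg divzK // sigmaE /writhe -sumrB.
elim/big_ind: _ => // [u v du dv|c _]; first exact: rpredD.
by rewrite /crossing_sign; case: ifP; case: ifP.
Qed.

End States.

(* Enhanced states; the labels 0 and 1 are false and true. *)
Definition enhancement (D : link_diagram) := {x : state D & {ffun circle x -> bool}}.

Section Complex.
Variable D : link_diagram.
Implicit Types (X Y : enhancement D) (c t : crossing D).

Definition label X (p : point D) : bool := tagged X (circle_of (tag X) p).

Definition tau X : int :=
  #|[set C | tagged X C]|%:Z - #|[set C | ~~ tagged X C]|%:Z.

Definition j_deg X : int := writhe D + i_deg (tag X) - tau X.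

Definition to_B (x : state D) c : state D := [ffun s => (s == c) || x s].

(* Y occurs (with coefficient 1) in d_c X. *)
Definition d_support c X Y : bool :=
  let x := tag X in
  [&& ~~ x c,
      tag Y == to_B x c,
      [forall p, [forall b, circle_of x p != arc_end x c b]
                 ==> (label Y p == label X p)]
    & let u := label X (foot c false) in let u' := label X (foot c true) in
      let v := label Y (foot c false) in let v' := label Y (foot c true) in
      if arc_end x c false != arc_end x c true
      then ~~ (u && u') && (v == (u || u'))
      else if u then v && v' else v (+) v'].

Definition a_sign X t : nat := #|[set s : crossing D | (s < t)%N && ~~ tag X s]|.

Variable R : nzRingType.

(* The free R-module on the enhanced states. *)
Definition chain := {ffun enhancement D -> R^o}.

Definition d_crossing c X : chain := [ffun Y => (d_support c X Y)%:R].

Definition d_gen X : chain :=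
  \sum_(t < ncross D) (-1) ^+ a_sign X t *: d_crossing t X.

Definition diff (f : chain) : chain := \sum_X f X *: d_gen X.

(* The chain f lies in C_R^{i,j}(x). *)
Definition in_graded_part (x : state D) (i j : int) (f : chain) : Prop :=
  forall X, f X != 0 -> [/\ tag X = x, i_deg (tag X) = i & j_deg X = j].

Definition nonzero_class (f : chain) : Prop :=
  diff f = 0 /\ ~ exists g : chain, diff g = f.

End Complex.

(* Main.v *)
Require Import Defs.
From mathcomp Require Import all_boot all_order all_algebra perm zify.

(* Call A-classes (B-classes) the components of the graph on all state circles
   whose edges are the A-arcs (B-arcs).  Let T be the bipartite graph whose
   vertices are the A-classes and the B-classes and whose edges are the circles,
   each joining the two classes that contain it.  T is connected because D is,
   and homogeneity makes it a tree; choose a root of T at one end of a circle C0.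

   The chain f is the sum of the enhancements in which each A-class has exactly
   one circle labeled 0, except that the root, if it is an A-class, has none.
   Changing the smoothing at an A-arc merges two circles of one A-class, and the
   terms of d f cancel in pairs that differ by exchanging the labels of these two
   circles (over Z, the signs come from the bipartition).  Dually, let phi be the
   sum modulo 2 of the coefficients of the enhancements in which each B-class has
   exactly one circle labeled 1, except that the root, if it is a B-class, has
   none; as x is reached only by splitting along B-arcs, phi vanishes on im d.
   The enhancements counted by phi f assign each circle to one of its two classes
   so that each class but the root gets exactly one circle.  In a tree there is
   exactly one such assignment, so phi f = 1.  The degree of f is j_x + 1 or
   j_x - 1 according to whether the root is a B-class or an A-class. *)

Set Implicit Arguments.
Unset Strict Implicit.
Unset Printing Implicit Defensive.

Import GRing.Theory Num.Theory.
Local Open Scope ring_scope.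

(** * Assigning the edges of a rooted tree to its vertices *)

Section RootedTree.
Variables (E : finType) (adj : bool -> rel E) (t0 : bool) (C0 : E).
Implicit Types (t : bool) (U V W : E) (S : {set E}) (L : {ffun E -> bool}).

(* The root is the [t0]-class of [C0]; label [t] assigns a circle to its
   [t]-class. *)
Definition saturated t S L : bool :=
  [forall V in S, #|[set W in S | connect (adj t) V W && (L W == t)]|
                  == ~~ ((t == t0) && connect (adj t) V C0)].

Definition adj_avoiding V : rel E := fun U W =>
  [&& U != V, W != V & [exists t, adj t U W]].

Hypothesis adjC : forall t, symmetric (adj t).

Lemma connect_adjC t : connect_sym (adj t).
Proof. exact: sym_connect_sym (@adjC t). Qed.

Lemma adj_avoidingC V : connect_sym (adj_avoiding V).
Proof.
apply: sym_connect_sym => U W; rewrite /adj_avoiding andbCA.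
by do 2!congr (_ && _); apply: eq_existsb => t; rewrite adjC.
Qed.

Lemma saturated_le1 t L U V : saturated t setT L -> connect (adj t) U V ->
  L U = t -> L V = t -> U = V.
Proof.
move=> /forall_inP/(_ U (in_setT _))/eqP satU UV LU LV; apply/eqP.
have sub : [set U; V] \subset [set W in setT | connect (adj t) U W && (L W == t)].
  apply/subsetP=> W; rewrite !inE /= => /orP[]/eqP->.
    by rewrite connect0 LU eqxx.
  by rewrite UV LV eqxx.
move: (subset_leq_card sub).
by rewrite satU cards2; case: eqVneq => // _; case: (~~ (_ && _)).
Qed.

(** Count class by class: each class holds one circle labeled [t], except a root class, which holds
    none; there [C0] is counted instead. *)
Lemma card_saturated t L : saturated t setT L ->
  (#|[set W | L W == t]| + (t == t0) = #|[set V in fingraph.roots (adj t)]|)%N.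
Proof.
move=> /forall_inP sat.
have rootsE (a : pred E) : #|[set W | a W]| = (\sum_(V in fingraph.roots (adj t))
    #|[set W in setT | connect (adj t) V W && a W]|)%N.
  rewrite -sum1_card (partition_big (fingraph.root (adj t)) (mem (fingraph.roots (adj t)))) /=;
    last by move=> W _; apply: (roots_root (@connect_adjC t)).
  apply: eq_bigr => V rV; rewrite -sum1_card; apply: eq_bigl => W.
  rewrite !inE /= andbC; congr (_ && _).
  by rewrite -(root_connect (@connect_adjC t)) (eqP rV) eq_sym.
have -> : #|[set V in fingraph.roots (adj t)]| = (\sum_(V in fingraph.roots (adj t)) 1)%N.
  by rewrite sum1_card cardsE.
(* Written as a cardinal, the correction term splits over the classes too. *)
have -> : (t == t0 : nat) = #|[set W | (t == t0) && (W == C0)]|.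
  case: eqP => _ /=; last by rewrite set_nil cards0.
  by rewrite (_ : [set W | _] = [set C0]) ?cards1 //; apply/setP=> W; rewrite !inE.
rewrite !rootsE -big_split; apply: eq_bigr => V rV /=.
rewrite (eqP (sat V (in_setT _))).
case: (t == t0) => /=; last by rewrite (_ : [set W in _ | _] = set0) ?cards0 //;
  apply/setP => W; rewrite !inE andbF.
case: (boolP (connect _ V C0)) => VC0 /=.
  rewrite (_ : [set W in _ | _] = [set C0]) ?cards1 //.
  by apply/setP => W; rewrite !inE /=; case: eqP => [->|]; rewrite ?VC0 ?andbF.
rewrite (_ : [set W in _ | _] = set0) ?cards0 //.
by apply/setP => W; rewrite !inE /=; case: eqP => [->|]; rewrite ?andbF // (negPf VC0).
Qed.

(** Acyclicity of T: no path avoiding the edge [V] links the two classes that [V] joins. *)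
Hypothesis adj_sep : forall t V U W,
  adj t V U -> adj (~~ t) V W -> ~~ connect (adj_avoiding V) U W.
Hypothesis adj_connected : forall U V, connect (fun U V => [exists t, adj t U V]) U V.

(** A path without repetition leaves [V] at its first step and never returns. *)
Lemma connect_neighbour t V W : connect (adj t) V W -> V != W ->
  exists2 U, adj t V U & connect (adj_avoiding V) U W.
Proof.
case/connectP=> p /shortenP[[|U q] /=]; first by move=> _ _ _ ->; rewrite eqxx.
case/andP=> VU qP /andP[Vq _] _ -> _; exists U => //.
apply/connectP; exists q => //; move: qP Vq {VU}.
elim: q U => //= W' q IH U /andP[UW' qP]; rewrite !inE !negb_or.
case/and3P=> VU VW' Vq; rewrite IH ?inE ?negb_or ?VW' // andbT.
rewrite /adj_avoiding eq_sym VU eq_sym VW' /=.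
by apply/existsP; exists t.
Qed.

Section Grow.
Variables (S : {set E}) (V W0 : E) (t : bool).
Hypotheses (C0S : C0 \in S) (VS : V \notin S).
Hypotheses (W0S : W0 \in S) (VW0 : adj (~~ t) V W0).
Hypothesis newV : forall W, W \in S -> ~~ connect (adj t) V W.

(** The [t]-class of [V] meets [V |: S] in [V] alone and is not the root, which contains [C0]; so
    [V] has to be its circle. *)
Lemma saturated_setU1_label L : saturated t (V |: S) L -> L V = t.
Proof.
move=> /forall_inP/(_ V (setU11 _ _)).
rewrite (negPf (newV C0S)) andbF /= => cardV.
have /card_gt0P[W] : (0 < #|[set W in V |: S | connect (adj t) V W && (L W == t)]|)%N.
  by rewrite (eqP cardV).
rewrite !inE => /andP[/orP[/eqP->|WS] /andP[VW /eqP //]].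
by rewrite (negPf (newV WS)) in VW.
Qed.

(** Labeled [t], the circle [V] counts only for its new class; its other class contains [W0], where
    the condition is already imposed. *)
Lemma saturated_setU1 s L : L V = t -> saturated s (V |: S) L = saturated s S L.
Proof.
move=> LV.
have setE U : U \in S -> [set W in V |: S | connect (adj s) U W && (L W == s)]
                       = [set W in S | connect (adj s) U W && (L W == s)].
  move=> US; apply/setP => W; rewrite !inE.
  case: (eqVneq W V) => [->|//] /=; rewrite (negPf VS) LV.
  case: eqP => [<-|]; last by rewrite andbF.
  by rewrite connect_adjC (negPf (newV US)).
apply/forall_inP/forall_inP => sat U.
  by move=> US; rewrite -setE // sat // inE US orbT.
rewrite 2!inE; case/orP=> [/eqP->|US]; last by rewrite setE ?sat.
case: (eqVneq s t) => [->|st].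
  rewrite (negPf (newV C0S)) andbF /=.
  rewrite (_ : [set W in _ | _] = [set V]) ?cards1 //; apply/setP => W.
  rewrite !inE; case: (eqVneq W V) => [->|_] /=; first by rewrite connect0 LV eqxx.
  by apply/and3P => -[WS VW _]; rewrite (negPf (newV WS)) in VW.
have {}st : s = ~~ t by move: st; case: (s); case: (t).
have VW0c : connect (adj s) V W0 by rewrite st connect1.
rewrite (same_connect (@connect_adjC s) VW0c) -(eqP (sat _ W0S)) -setE //.
by apply/eqP/eq_card => W; rewrite !inE (same_connect (@connect_adjC s) VW0c).
Qed.

End Grow.

Definition saturable S : Prop :=
  (exists L, forall t, saturated t S L) /\
  (forall L L', (forall t, saturated t S L) -> (forall t, saturated t S L') ->
     {in S, L =1 L'}).

Lemma saturable_set1 : saturable [set C0].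
Proof.
have satE t L : saturated t [set C0] L = ((L C0 == t) == (t != t0)).
  have setE V : V \in [set C0] -> [set W in [set C0] | connect (adj t) V W && (L W == t)]
     = if L C0 == t then [set C0] else set0.
    move=> /set1P->; case: ifP => LC0; apply/setP=> W; rewrite !inE; case: eqP => //= ->.
      by rewrite connect0 LC0.
    by rewrite LC0 andbF.
  apply/forall_inP/eqP => [/(_ C0 (set11 _))|LC0 V VC0].
    rewrite setE ?set11 // connect0 andbT.
    by case: (L C0 == t) => /=; rewrite ?cards0 ?cards1; case: (t != t0).
  rewrite setE // (set1P VC0) connect0 andbT LC0.
  by case: (t != t0); rewrite ?cards0 ?cards1.
split=> [|L L' sat sat' V /set1P->].
  (* The label [t0] would assign [C0] to the root. *)
  exists [ffun=> ~~ t0] => t; rewrite satE ffunE.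
  by case: (t0); case: t.
move: (sat true) (sat' true); rewrite !satE => /eqP LE /eqP L'E.
by move: L'E; rewrite -LE; case: (L C0); case: (L' C0).
Qed.

Lemma saturable_setU1 S V W0 t : C0 \in S -> V \notin S ->
    W0 \in S -> adj (~~ t) V W0 ->
    (forall W, W \in S -> ~~ connect (adj t) V W) ->
  saturable S -> saturable (V |: S).
Proof.
move=> C0S VS W0S VW0 newV [[L satL] uniqS].
have satU := saturated_setU1 C0S VS W0S VW0 newV.
split=> [|L1 L2 sat1 sat2].
  pose L' := [ffun W => if W == V then t else L W].
  have eqS W : W \in S -> L' W = L W.
    by move=> WS; rewrite ffunE (negPf (memPn VS _ WS)).
  exists L' => s; rewrite satU; last by rewrite ffunE eqxx.
  move/(_ s): satL => /forall_inP sat; apply/forall_inP=> U US.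
  rewrite -(eqP (sat U US)); apply/eqP/eq_card => W; rewrite !inE.
  by case WS: (W \in S); rewrite //= eqS.
have L1V := saturated_setU1_label C0S newV (sat1 t).
have L2V := saturated_setU1_label C0S newV (sat2 t).
move=> W; rewrite 2!inE => /orP[/eqP->|]; first by rewrite L1V L2V.
by apply: uniqS W => s; [rewrite -satU | rewrite -satU].
Qed.

(* Induction over the connected sets [S] containing the root, adding one
   neighbour [V] at a time: as [V] does not lie on a cycle, exactly one of
   its two classes is new, and it has to be assigned to that one. *)
Lemma saturable_setT : saturable [set: E].
Proof.
(* The linking invariant, that [S] hangs together without any outside [V], turns a second class of
   [V] meeting [S] into a cycle. *)
suff grow n S : #|~: S| = n -> C0 \in S ->
    (forall V U W, V \notin S -> U \in S -> W \in S ->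
       connect (adj_avoiding V) U W) ->
    saturable S -> saturable [set: E].
  apply: (grow _ [set C0]) (set11 _) _ saturable_set1; first by [].
  by move=> V U W _ /set1P-> /set1P->.
elim: n S => [|n IH] S cardS C0S linkS satS.
  by rewrite -setC0 -(cards0_eq cardS) setCK.
have [V VS [W0 W0S [s VW0]]] :
    exists2 V, V \notin S & exists2 W, W \in S & exists s, adj s V W.
  case: (pickP (fun p : E * E => [&& p.1 \notin S, p.2 \in S &
                                   [exists s, adj s p.1 p.2]])).
    by move=> [V W] /and3P[/= VS WS /existsP[s VW]]; exists V => //; exists W => //; exists s.
  move=> none; suff SE : S = setT by rewrite SE setCT cards0 in cardS.
  apply/setP=> W; rewrite inE; apply/idP.
  have clS : closed (fun U V => [exists t, adj t U V]) (mem S).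
    apply: intro_closed.
      apply: sym_connect_sym => U V.
      by apply: eq_existsb => t; rewrite adjC.
    move=> U V /existsP[t UV] US; apply/negPn/negP => VS.
    move: (none (V, U)); rewrite /= VS US /= => /existsP[].
    by exists t; rewrite adjC.
  by rewrite -(closed_connect clS (adj_connected C0 W)).
have newV W : W \in S -> ~~ connect (adj (~~ s)) V W.
  move=> WS; apply/negP => VW.
  have VneqW : V != W by apply: contraNneq VS => ->.
  have [U VU UW] := connect_neighbour VW VneqW.
  move: (adj_sep VW0 VU) => /negP[].
  by apply: connect_trans (linkS V W0 W VS W0S WS) _; rewrite adj_avoidingC.
apply: (IH (V |: S)); first last.
- by apply: (saturable_setU1 (t := ~~ s) C0S VS W0S) => //; rewrite negbK.
- move=> V' U W; rewrite !inE negb_or => /andP[V'V V'S].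
  have VW0' : connect (adj_avoiding V') V W0.
    apply: connect1; rewrite /adj_avoiding eq_sym V'V (memPn V'S) //=.
    by apply/existsP; exists s.
  have toW0 U' : (U' == V) || (U' \in S) -> connect (adj_avoiding V') U' W0.
    by case/orP=> [/eqP->//|U'S]; apply: linkS.
  move=> /toW0 UW0 /toW0; rewrite adj_avoidingC; exact: connect_trans.
- by rewrite inE C0S orbT.
- by move: cardS; rewrite setCU setIC -setDE (cardsD1 V) !inE VS => -[].
Qed.

End RootedTree.

(** * Parity under involutions; state circles; T is a tree *)

Lemma even_card_involution (T : finType) (f : T -> T) (S : {set T}) :
    involutive f -> {in S, forall z, f z \in S} -> {in S, forall z, f z != z} ->
  ~~ odd #|S|.
Proof.
move=> fK; have [n] := ubnP #|S|; elim: n S => // n IH S leSn fS fneq.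
case: (set_0Vmem S) => [->|[z zS]]; first by rewrite cards0.
have fzS : f z \in S :\ z by rewrite !inE fneq ?fS.
rewrite (cardsD1 z) zS (cardsD1 (f z)) fzS /= negbK; apply: IH.
- by move: leSn; rewrite (cardsD1 z S) zS (cardsD1 (f z) (S :\ z)) fzS !add1n ltnS; exact: ltnW.
- move=> w; rewrite !inE => /and3P[wfz wz wS].
  by rewrite fS // (inj_eq (inv_inj fK)) wz -{1}[z]fK (inj_eq (inv_inj fK)) wfz.
- by move=> w; rewrite !inE => /and3P[_ _ /fneq].
Qed.

Lemma smooth_ordK b : involutive (smooth_ord b).
Proof. by move=> i; apply/val_inj; case: b; case: i => [[|[|[|[|]]]]]. Qed.

Lemma smooth_ord_neq b i : smooth_ord b i != i.
Proof. by case: b; case: i => [[|[|[|[|]]]]]. Qed.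

Section StateCircles.
Variables (D : link_diagram) (x : state D).
Implicit Types (c : crossing D) (p q : point D) (U V W : circle x).

Lemma glue_neq (d : crossing D * 'I_4) : glue d != d.
Proof. by apply/eqP => gd; have := out_glue d; rewrite gd; case: (out d). Qed.

Lemma circle_adj_sym : symmetric (circle_adj x).
Proof.
case=> [[c i]|k] [[c' i']|k'] //=.
congr (_ || _); first by rewrite (can2_eq (@glueK D) (@glueK D)) eq_sym.
rewrite !xpair_eqE; case: (eqVneq c c') => [->|//] /=.
by rewrite (can2_eq (@smooth_ordK _) (@smooth_ordK _)) eq_sym.
Qed.

Lemma circle_connectC : connect_sym (circle_adj x).
Proof. exact: sym_connect_sym circle_adj_sym. Qed.

Lemma circle_of_eq p q : (circle_of x p == circle_of x q) = connect (circle_adj x) p q.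
Proof.
rewrite -val_eqE /= /circle_set; apply/eqP/idP => [/setP/(_ q)|pq].
  by rewrite !inE connect0.
by apply/setP => r; rewrite !inE (same_connect circle_connectC pq).
Qed.

Lemma circle_of_surj U : exists p, U = circle_of x p.
Proof. by case: U => S SP; case/imsetP: (SP) => p _ Sp; exists p; apply/val_inj. Qed.

(* The foot (in the sense of [foot]) to which the [b]-smoothing joins the dart [i]. *)
Definition arc_side (b : bool) (i : 'I_4) : bool := (i == 2) || (i == smooth_ord b 2).

Lemma arc_side_eq b i j : arc_side b i = arc_side b j -> (j == i) || (j == smooth_ord b i).
Proof.
by case: b; case: i => [[|[|[|[|]]]]] // ?; case: j => [[|[|[|[|]]]]].
Qed.

Lemma circle_of_dart c i : circle_of x (inl (c, i)) = arc_end x c (arc_side (x c) i).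
Proof.
apply/eqP; rewrite /arc_end circle_of_eq /foot.
set j := if _ then _ else _.
have: (i == j) || (smooth_ord (x c) i == j).
  by rewrite /j; case: (x c); case: (i) => [[|[|[|[|]]]]].
case/orP=> /eqP <-; first exact: connect0.
by apply: connect1; rewrite /= eqxx orbT.
Qed.

Lemma joinsC c U V : joins c U V = joins c V U.
Proof.
by apply/existsP/existsP => -[b]; rewrite andbC => bUV; exists (~~ b); rewrite negbK.
Qed.

Lemma joins_arc c b : joins c (arc_end x c b) (arc_end x c (~~ b)).
Proof. by apply/existsP; exists b; rewrite !eqxx. Qed.

Lemma part_adjC t : symmetric (@part_adj D x t).
Proof. by move=> U V; apply: eq_existsb => c; rewrite joinsC. Qed.

Lemma part_adj_arc c b : part_adj (x c) (arc_end x c b) (arc_end x c (~~ b)).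
Proof. by apply/existsP; exists c; rewrite eqxx joins_arc. Qed.

(** Gluing stays on one circle, and two darts of one crossing lie on one circle or on two joined by
    the arc there. *)
Lemma circles_connected : connected D ->
  forall U V, connect (fun U V => [exists t, part_adj t U V]) U V.
Proof.
move=> conn; set r := (r in connect r).
have rC : connect_sym r.
  by apply: sym_connect_sym => U V; apply: eq_existsb => t; rewrite part_adjC.
move=> U V; have [p ->] := circle_of_surj U; have [q ->] := circle_of_surj V.
have adjC : connect_sym (dart_adj (@glue D)).
  apply: sym_connect_sym => d e; rewrite /dart_adj eq_sym.
  by rewrite (can2_eq (@glueK D) (@glueK D)) [glue _ == _]eq_sym.
have dart_conn d e : connect (dart_adj (@glue D)) d e ->
    connect r (circle_of x (inl d)) (circle_of x (inl e)).
  case/connectP=> s + ->; elim: s d => //= f s IH d /andP[df /IH].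
  apply: connect_trans; case/orP: df => [|/eqP gd]; last first.
    rewrite (_ : circle_of x _ = circle_of x (inl f)) ?connect0 //.
    by apply/eqP; rewrite circle_of_eq connect1 //= gd eqxx.
  case: d f => [c i] [c' j] /= /eqP <-; rewrite !circle_of_dart.
  case: (eqVneq (arc_side (x c) i) (arc_side (x c) j)) => [->|]; first exact: connect0.
  rewrite -addbN => ij; rewrite (_ : arc_side _ j = ~~ arc_side (x c) i); last first.
    by move: ij; case: (arc_side _ i); case: (arc_side _ j).
  by apply: connect1; apply/existsP; exists (x c); exact: part_adj_arc.
(* [A] has one dart per component with crossings; together with [nloop] these total one, so two
   points are both darts or the same loop. *)
set A := predI (fingraph.roots (dart_adj (@glue D))) predT.
have rootA d : fingraph.root (dart_adj (@glue D)) d \in A.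
  by rewrite !inE andbT; apply: roots_root.
have {conn} /eqP conn : (#|A| + nloop D == 1)%N := conn.
have A1 : (#|A| <= 1)%N by have := leq_addr (nloop D) #|A|; rewrite conn.
have noloop (d : crossing D * 'I_4) : 'I_(nloop D) -> False.
  case=> l /(leq_ltn_trans (leq0n l)); move: conn; rewrite (cardD1 (fingraph.root (dart_adj (@glue D)) d) A) rootA.
  by move/eqP; rewrite eqSS addn_eq0 => /andP[_ /eqP->].
case: p q => [d|k] [e|l].
- apply: dart_conn; rewrite -(root_connect adjC); apply/eqP.
  exact: (card_le1_eqP A1).
- by case: (noloop d l).
- by case: (noloop e k).
rewrite (_ : k = l) ?connect0 //; apply/val_inj.
have: (nloop D <= 1)%N by have := leq_addl #|A| (nloop D); rewrite conn.
move=> nl1; move: (leq_trans (ltn_ord k) nl1) (leq_trans (ltn_ord l) nl1).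
by rewrite !ltnS !leqn0 => /eqP k0 /eqP l0; apply: etrans k0 (esym l0).
Qed.


(** If [U] and [W] were linked off [V], the arcs from [V] to them would stay in one block after all
    cuts, although their types differ. *)
Lemma homogeneous_separates t V U W : homogeneously_adequate x ->
  part_adj t V U -> part_adj (~~ t) V W ->
  ~~ connect (adj_avoiding (@part_adj D x) V) U W.
Proof.
move=> /andP[/forall_inP homog /forallP adeq].
have neq c b : arc_end x c (~~ b) != arc_end x c b.
  by case: b; [|rewrite eq_sym]; apply: adeq.
case/existsP=> c /andP[/eqP xc /existsP[b /andP[/eqP VE /eqP UE]]].
case/existsP=> c' /andP[/eqP xc' /existsP[b' /andP[/eqP VE' /eqP WE]]].
apply/negP => UW.
have cc' : cut_adj x c c'.
  apply/existsP; exists b; apply/existsP; exists b' => /=.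
  rewrite VE VE' UE WE eqxx /= -UE -VE neq VE -WE -[in X in _ && X]VE' neq VE' UE WE /=.
  apply/implyP => _; rewrite (eq_connect (e' := adj_avoiding (@part_adj D x) V)) //.
  move=> C C'; rewrite /del_adj /adj_avoiding; do 2!congr (_ && _).
  apply/existsP/existsP => [[d CC']|[s /existsP[d /andP[_ CC']]]]; last by exists d.
  by exists (x d); apply/existsP; exists d; rewrite eqxx.
have /homog/negP[] : [set d | connect (cut_adj x) c d] \in blocks x by apply: imset_f.
have cin : c \in [set d | connect (cut_adj x) c d] by rewrite inE connect0.
have c'in : c' \in [set d | connect (cut_adj x) c d] by rewrite inE connect1.
by case: (t) xc xc' => xc xc'; apply/andP; split; apply/exists_inP;
  [exists c' | exists c | exists c | exists c']; rewrite ?xc ?xc'.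
Qed.

End StateCircles.

(** * Changing the smoothing at an arc with distinct ends *)

Section Resmoothing.
Variables (D : link_diagram) (x : state D) (c : crossing D).
Hypothesis ends_neq : arc_end x c false != arc_end x c true.

(** The state circles opened at [c], a relation shared by both smoothings there. *)
Definition adj_off_crossing : rel (point D) := fun p q =>
  match p, q with
  | inl d, inl e =>
      (glue d == e) || ((d.1 != c) && ((d.1, smooth_ord (x d.1) d.2) == e))
  | _, _ => p == q
  end.

Lemma adj_off_crossing_sub : subrel adj_off_crossing (circle_adj x).
Proof.
case=> [d|k] [e|l] //= /orP[->//|/andP[_ ->]]; exact: orbT.
Qed.

(* Away from the darts at [c], a component of [adj_off_crossing] is closed
   under two involutions without fixed points, so it contains an even number
   of darts at [c]. *)
Lemma connect_off_crossing i :
  connect adj_off_crossing (inl (c, i)) (inl (c, smooth_ord (x c) i)).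
Proof.
pose S := [set d | connect adj_off_crossing (inl (c, i)) (inl d)].
pose K := [set d : crossing D * 'I_4 | d.1 == c].
pose s (d : crossing D * 'I_4) := (d.1, smooth_ord (x d.1) d.2).
have evenS : ~~ odd #|S|.
  apply: (even_card_involution (@glueK D)) => d; rewrite ?inE ?glue_neq // => cd.
  by apply: connect_trans cd (connect1 _); rewrite /= eqxx.
have evenSK : ~~ odd #|S :\: K|.
  apply: (@even_card_involution _ s) => [d|d|d].
  - by rewrite /s /= smooth_ordK; case: d.
  - rewrite !inE /= => /andP[dc cd]; rewrite dc /=.
    by apply: connect_trans cd (connect1 _); rewrite /= dc eqxx orbT.
  - by case: d => d j _; rewrite /s xpair_eqE eqxx smooth_ord_neq.
have ciSK : (c, i) \in S :&: K by rewrite !inE connect0 eqxx.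
have : ~~ odd #|S :&: K| by rewrite -(cardsID K) oddD (negPf evenSK) addbF in evenS.
rewrite (cardsD1 (c, i)) ciSK oddD /= negbK.
(* Parity yields a second dart at [c]; the other strand at [c] lies on another circle, so this dart
   is the partner of [i]. *)
case: (set_0Vmem ((S :&: K) :\ (c, i))) => [->|[[c' j]]]; first by rewrite cards0.
rewrite !inE xpair_eqE => /and3P[ji cj /eqP/= c'c] _; rewrite c'c eqxx /= in ji cj *.
suff <- : j = smooth_ord (x c) i by [].
have : circle_of x (inl (c, i)) = circle_of x (inl (c, j)).
  apply/eqP; rewrite circle_of_eq; apply: connect_sub cj => p q pq.
  by apply: connect1; apply: adj_off_crossing_sub.
rewrite !circle_of_dart => /eqP; case: (eqVneq (arc_side (x c) i) (arc_side (x c) j)).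
  by move/arc_side_eq; rewrite (negPf ji) => /eqP.
have ends_neq' := ends_neq; rewrite eq_sym in ends_neq'.
by case: (arc_side _ i); case: (arc_side _ j) => // _;
  rewrite ?(negPf ends_neq) ?(negPf ends_neq').
Qed.

Variable y : state D.
Hypotheses (y_off : forall s, s != c -> y s = x s) (y_at : y c = ~~ x c).

Lemma resmoothing_connect_off : subrel (connect adj_off_crossing) (connect (circle_adj y)).
Proof.
apply: connect_sub => [[d|k] [e|l]] //= pq; apply: connect1 => //=.
by case/orP: pq => [->//|/andP[/y_off-> ->]]; rewrite orbT.
Qed.

(** The link lost at [c] is replaced by the detour around the rest of its circle. *)
Lemma resmoothing_connect : subrel (connect (circle_adj x)) (connect (circle_adj y)).
Proof.
apply: connect_sub => [[[c' i]|k] [e|l]] //= pq; last exact: connect1.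
have {pq}[/eqP<-|/eqP<-] := orP pq; first by apply: connect1; rewrite /= eqxx.
case: (eqVneq c' c) => [->|c'c].
  exact: resmoothing_connect_off (connect_off_crossing i).
by apply: connect1; rewrite /= -y_off // eqxx orbT.
Qed.

Lemma resmoothing_merges : arc_end y c false = arc_end y c true.
Proof.
apply/eqP; rewrite circle_of_eq.
have step b i : connect (circle_adj y) (inl (c, i)) (inl (c, smooth_ord b i)).
  case: (eqVneq b (x c)) => [->|bx].
    exact: resmoothing_connect_off (connect_off_crossing i).
  apply: connect1; rewrite /= y_at.
  by rewrite (_ : ~~ x c = b) ?eqxx ?orbT //; case: (b) bx; case: (x c).
(* Dart 0 leads to 3 by the B-smoothing, then to 2 by the A-smoothing; one link belongs to [y], the
   other is a detour. *)
apply: connect_trans (step true 0) _.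
rewrite (_ : foot c true = inl (c, smooth_ord false (smooth_ord true 0))) ?step //.
by congr (inl (_, _)); apply/val_inj.
Qed.

End Resmoothing.

(** * Cancellation by exchanging two labels *)

Section LabelSwap.
Variables (E : finType) (U V : E).

Definition swap_labels (L : {ffun E -> bool}) : {ffun E -> bool} :=
  [ffun W => L (tperm U V W)].

Lemma swap_labelsK : involutive swap_labels.
Proof. by move=> L; apply/ffunP => W; rewrite !ffunE tpermK. Qed.

(** The swap permutes circles within each [t]-class, so its count is unchanged. *)
Lemma saturated_swap_labels (adj : bool -> rel E) t0 C0 t L :
    symmetric (adj t) -> connect (adj t) U V ->
  saturated adj t0 C0 t setT (swap_labels L) = saturated adj t0 C0 t setT L.
Proof.
move=> /sym_connect_sym adjC UV; apply: eq_forallb_in => W _.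
rewrite -(card_imset _ (inv_inj (tpermK U V))); congr (_ == _).
apply: eq_card => Z; rewrite -(tpermK U V Z) (mem_imset _ _ (inv_inj (tpermK U V))).
rewrite tpermK !inE !ffunE /= tpermK; congr (_ && _).
by case: tpermP => [->|->|//]; rewrite ![connect _ W _]adjC (same_connect adjC UV).
Qed.

Lemma sum_swap_labels (M : zmodType) (F : {ffun E -> bool} -> M) :
    (forall L : {ffun E -> bool}, L U = L V -> F L = 0) ->
    (forall L : {ffun E -> bool}, ~~ L U -> L V -> F (swap_labels L) = - F L) ->
  \sum_L F L = 0.
Proof.
move=> Feq Fswap; rewrite (bigID (fun L : {ffun E -> bool} => L U)) /=.
(* The half with [U] labeled 1, reindexed by the swap, is compared with the other half term by
   term. *)
rewrite (reindex_inj (inv_inj swap_labelsK)) !(big_mkcond (fun=> _)) /=.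
rewrite big_mkcond [X in _ + X]big_mkcond -big_split big1 //= => L _.
rewrite ffunE tpermL; case LU: (L U); case LV: (L V) => /=; rewrite ?addr0 ?add0r //.
- by apply: Feq; rewrite !ffunE tpermL tpermR LU LV.
- by rewrite Fswap ?LU ?LV // addNr.
- by apply: Feq; rewrite LU LV.
Qed.

End LabelSwap.

(** * The chain f: cycle, nonzero class, degree *)

Lemma diffE (D : link_diagram) (R : nzRingType) (f : chain D R) Y :
  diff f Y = \sum_t \sum_X f X * ((-1) ^+ a_sign X t * (d_support t X Y)%:R).
Proof.
rewrite exchange_big sum_ffunE; apply: eq_bigr => X _.
rewrite ffunE sum_ffunE -mulr_sumr; congr (_ * _).
by apply: eq_bigr => t _; rewrite !ffunE.
Qed.

Section TreeChain.
Variables (D : link_diagram) (x : state D) (conn : connected D).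
Hypothesis hx : homogeneously_adequate x.
Variables (t0 : bool) (C0 : circle x).
Implicit Types (L : {ffun circle x -> bool}) (X Y : enhancement D).

Notation saturated t L := (saturated (@part_adj D x) t0 C0 t setT L).
Notation enhance L := (Tagged (fun y : state D => {ffun circle y -> bool}) L : enhancement D).

Lemma adequate_ends c : arc_end x c false != arc_end x c true.
Proof. by case/andP: hx => _ /forallP. Qed.

Lemma label_foot L c b : label (enhance L) (foot c b) = L (arc_end x c b).
Proof. by []. Qed.

Lemma connect_arc c : connect (part_adj (x c)) (arc_end x c false) (arc_end x c true).
Proof. exact: connect1 (part_adj_arc x c false). Qed.

Lemma saturated_arc c L : saturated (x c) L ->
  ~~ [&& L (arc_end x c false) == x c & L (arc_end x c true) == x c].
Proof.
move=> sat; apply/andP => -[/eqP L0 /eqP L1]; move: (adequate_ends c).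
by rewrite (saturated_le1 sat (connect_arc c) L0 L1) eqxx.
Qed.

Lemma saturable_circles : saturable (@part_adj D x) t0 C0 [set: circle x].
Proof.
apply: saturable_setT; first exact: part_adjC.
  by move=> t V U W; apply: homogeneous_separates.
exact: circles_connected.
Qed.

(** A saturated labeling matches the circles with the classes other than the root: the vertex-edge
    count of the tree T. *)
Lemma card_circle_tree :
  (#|[set V in fingraph.roots (@part_adj D x false)]|
   + #|[set V in fingraph.roots (@part_adj D x true)]| = #|{: circle x}|.+1)%N.
Proof.
have [[L satL] _] := saturable_circles.
have arith (a b u v n m k : nat) : (a + u = n -> b + v = m -> a + b = k -> u + v = 1 ->
  n + m = k.+1)%N by lia.
apply: arith (card_saturated (@part_adjC D x) (satL false))
             (card_saturated (@part_adjC D x) (satL true)) _ _; last by case: (t0).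
rewrite -(cardsC [set W | L W == true]) addnC; congr (_ + _)%N.
by apply: eq_card => W; rewrite !inE; case: (L W).
Qed.

(** A circle outside [part_circles x t] is a class by itself; the other classes are the zones. *)
Lemma card_roots t :
  (#|[set V in fingraph.roots (@part_adj D x t)]| + #|part_circles x t|
   = nzones x t + #|{: circle x}|)%N.
Proof.
suff -> : (#|[set V in fingraph.roots (@part_adj D x t)]|
           = nzones x t + #|~: part_circles x t|)%N.
  by rewrite -addnA [X in (_ + X)%N]addnC cardsC.
apply: etrans (esym (cardsID (part_circles x t) _)) _; congr (_ + _)%N; last first.
  apply: eq_card => V; rewrite in_setD in_setC andb_idr // => VP; rewrite inE.
  case/connectP: (connect_root (@part_adj D x t) V) => [[|U p] /=].
    by move=> _ rV; apply/eqP.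
  case/andP=> /existsP[c /andP[xc /existsP[b /andP[bV _]]]] _ _.
  case/negP: VP; rewrite inE; apply/existsP; exists c; apply/existsP; exists b.
  by rewrite xc.
by apply: eq_card => V; rewrite !inE.
Qed.

Variables (R : comNzRingType) (s : circle x -> R).

(** With [s] alternating across A-arcs, moving a 0 along such an arc negates the product. *)
Definition tree_weight L : R := if saturated false L then \prod_(W | ~~ L W) s W else 0.

(** The sum has at most one term; it avoids transporting labels along an equality of states. *)
Definition tree_chain : chain D R := [ffun X => \sum_(L | enhance L == X) tree_weight L].

Lemma tree_chainE L : tree_chain (enhance L) = tree_weight L.
Proof. by rewrite ffunE (big_pred1 L) // => L'; rewrite eq_Tagged. Qed.

Lemma tree_chain_supp X : tree_chain X != 0 -> exists2 L, X = enhance L & saturated false L.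
Proof.
rewrite ffunE => fX; case: (pickP (fun L => (enhance L == X) && saturated false L)).
  by move=> L /andP[/eqP<- satL]; exists L.
move=> none; case/eqP: fX; apply: big1 => L LX.
by rewrite /tree_weight; move: (none L); rewrite LX /= => ->.
Qed.

Lemma sum_tree_chain (F : enhancement D -> R) :
  \sum_X tree_chain X * F X = \sum_L tree_weight L * F (enhance L).
Proof.
rewrite (partition_big (fun L => enhance L) predT) //=; apply: eq_bigr => X _.
by rewrite ffunE mulr_suml; apply: eq_bigr => L /eqP->.
Qed.

Hypothesis s_arc : forall c, ~~ x c -> s (arc_end x c false) = - s (arc_end x c true).

Lemma tree_weight_swap c L : ~~ x c ->
    ~~ L (arc_end x c false) -> L (arc_end x c true) ->
  tree_weight (swap_labels (arc_end x c false) (arc_end x c true) L) = - tree_weight L.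
Proof.
move=> xc LU LV; have UV := connect_arc c; rewrite (negPf xc) in UV.
rewrite /tree_weight (saturated_swap_labels _ _ _ (@part_adjC D x false) UV).
case: ifP => _; last by rewrite oppr0.
rewrite (reindex_inj (@perm_inj _ (tperm (arc_end x c false) (arc_end x c true)))) /=.
rewrite (eq_bigl (fun W => ~~ L W)); last by move=> W; rewrite ffunE tpermK.
rewrite [in RHS](bigD1 (arc_end x c false)) // [in LHS](bigD1 (arc_end x c false)) //=.
rewrite tpermL (s_arc xc) mulNr opprK; congr (_ * _).
apply: eq_bigr => W /andP[LW WU]; rewrite tpermD // eq_sym //.
by apply: contraNneq LW => ->.
Qed.

(** At an A-arc, end labels (1,1) merge to zero, (0,0) is excluded by saturation, and (0,1), (1,0)
    have equal images and opposite weights. *)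
Lemma tree_chain_cycle : diff tree_chain = 0.
Proof.
apply/ffunP => Y; rewrite diffE ffunE; apply: big1 => c _.
rewrite (sum_tree_chain (fun X => (-1) ^+ a_sign X c * (d_support c X Y)%:R)).
case xc: (x c).
  by apply: big1 => L _; rewrite /d_support /= xc !mulr0.
have adeq := adequate_ends c.
apply: (@sum_swap_labels _ (arc_end x c false) (arc_end x c true)) => L LE.
  case supp: (d_support _ _ _); last by rewrite !mulr0.
  case/and4P: supp => _ _ _; rewrite adeq !label_foot.
  rewrite /tree_weight; case: ifP => [sat|_ _]; last by rewrite mul0r.
  rewrite LE andbb => /andP[LV _].
  have := @saturated_arc c L; rewrite xc LE (negPf LV) => /(_ sat).
  by rewrite eqxx.
move=> LV; rewrite tree_weight_swap ?xc // mulNr; congr (- (_ * (_ * _))).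
congr ((nat_of_bool _)%:R); rewrite /d_support adeq /=; do 2!congr (_ && _).
congr (_ && _).
  apply: eq_forallb => p; case: (boolP [forall b, _]) => //= /forallP pc.
  by rewrite /label /= ffunE tpermD // eq_sym pc.
rewrite !label_foot !ffunE tpermL tpermR.
by rewrite [L _ && _]andbC [L _ || _]orbC.
Qed.

(** If [x] arises from [tag X] at [t], it does so by a split. Label 1 gives (1,1), excluded by
    saturation; label 0 gives (1,0) and (0,1), paired by the swap. *)
Lemma sum_d_support_saturated t X :
  \sum_(L | saturated true L) (d_support t X (enhance L))%:R = 0 :> 'F_2.
Proof.
case: (boolP (~~ tag X t && (x == to_B (tag X) t))) => [|none]; last first.
  apply: big1 => L _; case supp: (d_support _ _ _) => //.
  by case/and4P: supp => /= Xt xE _ _; rewrite Xt xE in none.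
move=> /andP[Xt /eqP xE].
have xt : x t by rewrite xE ffunE eqxx.
have X_off c : c != t -> tag X c = x c by move=> ct; rewrite xE ffunE (negPf ct).
have X_at : tag X t = ~~ x t by rewrite xt (negPf Xt).
have ends := adequate_ends t; have UV := connect_arc t; rewrite xt in UV.
have merged := resmoothing_merges ends X_off X_at.
rewrite big_mkcond; apply: (@sum_swap_labels _ (arc_end x t false) (arc_end x t true)) => L.
  move=> LE; case: ifP => // sat; case supp: (d_support _ _ _) => //.
  case/and4P: supp => _ _ _; rewrite merged eqxx /= !label_foot LE addbb andbb.
  case: (label X _) => // LV; have := @saturated_arc t L; rewrite xt => /(_ sat).
  by rewrite LE LV.
move=> LU LV; rewrite (saturated_swap_labels _ _ _ (@part_adjC D x true) UV).
rewrite oppr_pchar2 ?pchar_Fp //; case: ifP => // _; congr ((nat_of_bool _)%:R).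
rewrite /d_support merged eqxx /=; congr [&& _, _, _ & _].
  (* Both ends of the arc in [x] lie within the split circle of [tag X], so the swap affects no
     circle away from it. *)
  apply: eq_forallb => p; case: (boolP [forall b, _]) => //= /forallP pc.
  rewrite /label /= ffunE tpermD // eq_sym circle_of_eq; apply/negP => pt.
    have := pc false; rewrite circle_of_eq.
    by rewrite (resmoothing_connect ends X_off pt).
  have := pc true; rewrite circle_of_eq.
  by rewrite (resmoothing_connect ends X_off pt).
by rewrite !label_foot !ffunE tpermL tpermR [L _ && _]andbC [L _ (+) _]addbC.
Qed.

Variable rho : {rmorphism R -> 'F_2}.

(** This is phi after reduction modulo 2 by [rho], so one functional serves both coefficient
    rings. *)
Lemma sum_diff_saturated (g : chain D R) :
  \sum_(L | saturated true L) rho (diff g (enhance L)) = 0.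
Proof.
under eq_bigr => L _ do rewrite diffE rmorph_sum.
rewrite exchange_big big1 //= => t _.
under eq_bigr => L _ do rewrite rmorph_sum.
rewrite exchange_big big1 //= => X _.
under eq_bigr => L _ do rewrite !rmorphM rmorph_nat mulrA.
by rewrite -mulr_sumr sum_d_support_saturated mulr0.
Qed.

Hypothesis rho_s : forall W, rho (s W) = 1.

Lemma tree_chain_nonzero_class : nonzero_class tree_chain.
Proof.
split=> [|[g gE]]; first exact: tree_chain_cycle.
have := sum_diff_saturated g; rewrite gE.
have [[L satL] uniqL] := saturable_circles.
(* Only the labeling saturated for both types contributes, and its weight reduces to 1. *)
rewrite (bigD1 L) //= big1 ?addr0 => [|L' /andP[satL' L'L]].
  rewrite tree_chainE /tree_weight satL rmorph_prod.
  by rewrite (eq_bigr (fun=> 1)) ?big1_eq // => W _; rewrite rho_s.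
rewrite tree_chainE /tree_weight; case: ifP => [satA|_]; last exact: rmorph0.
case/eqP: L'L; apply/ffunP => W; apply: (uniqL L' L) => // -[] //.
Qed.

Lemma tree_chain_in_graded_part :
  in_graded_part x (i_deg x) (j_state x + (if t0 then 1 else -1)) tree_chain.
Proof.
move=> X /tree_chain_supp[L -> sat]; split=> //; rewrite /j_deg /tau /j_state /=.
have cardL : (#|[set W | L W]| + #|[set W | L W == false]| = #|{: circle x}|)%N.
  rewrite -(cardsC [set W | L W]); congr (_ + _)%N.
  by apply: eq_card => W; rewrite !inE; case: (L W).
have -> : [set W | ~~ L W] = [set W | L W == false].
  by apply/setP => W; rewrite !inE; case: (L W).
(* [b] counts the circles labeled 0: one per A-class, one fewer if the root is an A-class, so the
   two kinds of root give degrees 2 apart. *)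
have arith (a b n nA nB pA pB zA zB : nat) (w i : int) :
    (a + b = n)%N -> (b + (false == t0) = nA)%N -> (nA + nB = n.+1)%N ->
    (nA + pA = zA + n)%N -> (nB + pB = zB + n)%N ->
  w + i - (a%:Z - b%:Z) =
  w + i + pB%:Z - pA%:Z + zA%:Z - zB%:Z + (if t0 then 1 else -1) by case: (t0); lia.
exact: arith cardL (card_saturated (@part_adjC D x) sat) card_circle_tree
             (card_roots false) (card_roots true).
Qed.

End TreeChain.

(** * Choice of [C0] and of the coefficients *)

Lemma connected_inhabited (D : link_diagram) : connected D -> exists p : point D, true.
Proof.
move=> conn; case: (pickP (predT : pred (point D))) => [p _|none]; first by exists p.
move: conn; rewrite /connected /n_comp_mem eq_card0 => [|d]; last first.
  by have := none (inl d).
rewrite add0n => /eqP nl; have lt0 : (0 < nloop D)%N by rewrite nl.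
by have := none (inr (Ordinal lt0)).
Qed.

Lemma oppr1_F2 : - 1 = 1 :> 'F_2.
Proof. by apply/val_inj. Qed.

Lemma nonzero_class_F2 (D : link_diagram) (x : state D) (t0 : bool) :
    connected D -> homogeneously_adequate x ->
  exists f : chain D 'F_2,
    in_graded_part x (i_deg x) (j_state x + (if t0 then 1 else -1)) f /\ nonzero_class f.
Proof.
move=> conn hx; have [p _] := connected_inhabited conn.
exists (tree_chain t0 (circle_of x p) (fun=> 1)); split.
  exact: tree_chain_in_graded_part.
apply: (tree_chain_nonzero_class conn hx _ _ _ (rho := idfun)) => //.
by move=> c _; rewrite oppr1_F2.
Qed.

Lemma nonzero_class_int (D : link_diagram) (x : state D) (t0 : bool) :
    connected D -> homogeneously_adequate x -> part_bipartite x false ->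
  exists f : chain D int,
    in_graded_part x (i_deg x) (j_state x + (if t0 then 1 else -1)) f /\ nonzero_class f.
Proof.
move=> conn hx [col colP]; have [p _] := connected_inhabited conn.
(* The bipartition gives signs that alternate across A-arcs and become 1 modulo 2. *)
exists (tree_chain t0 (circle_of x p) (fun W => (-1) ^+ col W)); split.
  exact: tree_chain_in_graded_part.
apply: (tree_chain_nonzero_class conn hx _ _ _ (rho := intr)) => [c /negPf xc|W].
  by have := colP c xc; case: (col _); case: (col _).
by rewrite rmorph_sign oppr1_F2 expr1n.
Qed.

Theorem mainTheorem1 (D : link_diagram) (x : state D)
  (conn : connected D) (hx : homogeneously_adequate x) :
  [/\ exists f : chain D 'F_2,
        in_graded_part x (i_deg x) (j_state x + 1) f /\ nonzero_class f,
      exists f : chain D 'F_2,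
        in_graded_part x (i_deg x) (j_state x - 1) f /\ nonzero_class f
    & part_bipartite x false ->
      (exists f : chain D int,
         in_graded_part x (i_deg x) (j_state x + 1) f /\ nonzero_class f) /\
      (exists f : chain D int,
         in_graded_part x (i_deg x) (j_state x - 1) f /\ nonzero_class f)].
Proof.
split=> [||bip].
- exact: (nonzero_class_F2 true conn hx).
- exact: (nonzero_class_F2 false conn hx).
by split; [exact: (nonzero_class_int true conn hx bip)
          | exact: (nonzero_class_int false conn hx bip)].
Qed.
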